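(* (1) Let $X\subset\mathbb{P}^3$ be a weak determinantal surface whose type $(\hat a,\hat b)$ is one of the following weak admissible pairs of degree $4$ (where $k,m,n$ are integers). Then $X$ is reducible: Length $2$ ($n\ge 0$): $((0,2+n),(2,4+n))$; $((0,3+n),(3,4+n))$; $((0,1+n),(1,4+n))$. Length $3$: $((0,1,2+n),(2,2,3+n))$, $n\ge0$; $((0,2+n,2+n),(2,3+n,3+n))$, $n\ge0$; $((0,2+n,3+n),(2,3+n,4+n))$, $n\ge0$; $((0,2+m,2+n),(2,3+m,3+n))$, $0\le m<n$; $((0,0,1+n),(1,1,3+n))$, $n\ge0$; $((0,1+n,1+n),(1,2+n,3+n))$, $n\ge0$; $((0,1,2+n),(1,2,4+n))$, $n\ge0$; $((0,m,1+n),(1,1+m,3+n))$, $1\le m<n$; $((0,0,2+n),(1,2,3+n))$, $n\ge0$; $((0,1+n,2+n),(1,3+n,3+n))$, $n\ge0$; $((0,1+m,3+n),(1,3+m,4+n))$, $0\le m\le n$. Length $4$: $((0,0,0,1+n),(1,1,1,2+n))$, $n\ge0$; $((0,1+n,1+n,1+n),(1,2+n,2+n,2+n))$, $n\ge0$; $((0,0,1+n,1+n),(1,1,2+n,2+n))$, $n\ge0$; $((0,0,1+m,2+n),(1,1,2+m,3+n))$, $0\le m\le n$; $((0,1+m,2+n,2+n),(1,2+m,3+n,3+n))$, $0\le m\le n$; $((0,1+k,2+m,3+n),(1,2+k,3+m,4+n))$, $0\le k\le m\le n$. (2) If $X\subset\mathbb{P}^3$ is a smooth weak determinantal surface of degree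 $4$, then $X$ is determinantal or it is weak determinantal of type $((0,0,1),(1,2,2))$.
   Context: We work over $\mathbb{C}$. Weak admissible pair: two sequences of integers $\hat a=(a_1,\ldots,a_t)$, $\hat b=(b_1,\ldots,b_t)$ with $t\ge 2$, $a_1\le\cdots\le a_t$, $b_1\le\cdots\le b_t$, and $a_i<b_i$ for all $1\le i\le t$. Its degree is $\sum_{i=1}^t(b_i-a_i)$ and its length is $t$. Given a weak admissible pair $(\hat a,\hat b)$ of degree $d$ and length $t$, a surface $X=V(F)\subset\mathbb{P}^3$ is weak determinantal of type $(\hat a,\hat b)$ if $F=\det(S)$ for some $t\times t$ matrix $S=(m_{ij})$ where $m_{ij}$ is a homogeneous polynomial of degree $b_j-a_i$, with $m_{ij}=0$ whenever $a_i\ge b_j$. A weak determinantal surface of degree $d$ is a weak determinantal surface whose type is some weak admissible pair of degree $d$. A surface is determinantal if it is weak determinantal of some type $(\hat a,\hat b)$ with $a_i<b_j$ for all $i,j\in\{1,\ldots,t\}$. *)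

(* Defs.v *)
From mathcomp Require Import all_boot all_order all_algebra.
From mathcomp Require Import reals complex mpoly.

Set Implicit Arguments.
Unset Strict Implicit.
Unset Printing Implicit Defensive.

Import Order.TTheory GRing.Theory Num.Theory.

Local Open Scope ring_scope.

Section WeakAdmissible.
Variable t : nat.
Implicit Types a b : t.-tuple int.

Definition weak_admissible a b : Prop :=
  [/\ (2 <= t)%N, sorted <=%R a, sorted <=%R b
    & forall i : 'I_t, tnth a i < tnth b i].

Definition pair_degree a b : int := \sum_(i < t) (tnth b i - tnth a i).

End WeakAdmissible.

Section Surfaces.
Variable R : realType.
Implicit Types F : {mpoly R[i][4]}.

(* The complex numbers are R[i].  The surface V(F) of P^3 is taken with its
   scheme structure (equivalently, as an effective divisor) and is represented
   by its equation F, a nonzero form of positive degree, unique up to a nonzero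
   constant.  The predicates on F below are invariant under such rescaling. *)
Definition surface F : Prop :=
  F != 0 /\ exists2 d : nat, (0 < d)%N & F \is d.-homog.

(* V(F) is the union (the sum, as divisors) of two surfaces; with multiplicities
   taken into account, a double quadric is reducible. *)
Definition reducible F : Prop :=
  exists G H : {mpoly R[i][4]}, [/\ surface G, surface H & F = G * H].

(* Points of P^3 are given by their homogeneous coordinates p. *)
Definition smooth F : Prop :=
  forall p : 'I_4 -> R[i], (exists i, p i != 0) ->
    F.@[p] = 0 -> exists i : 'I_4, (F^`M(i)).@[p] != 0.

Definition weak_determinantal t (a b : t.-tuple int) F : Prop :=
  weak_admissible a b /\
  exists S : 'M[{mpoly R[i][4]}]_t,
    [/\ forall i j, tnth a i < tnth b j ->
          S i j \is `|tnth b j - tnth a i|%N.-homog,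
        forall i j, tnth b j <= tnth a i -> S i j = 0
      & F = \det S].

Definition weak_determinantal_of_degree (d : nat) F : Prop :=
  exists (t : nat) (a b : t.-tuple int),
    pair_degree a b = d%:Z /\ weak_determinantal a b F.

Definition determinantal F : Prop :=
  exists (t : nat) (a b : t.-tuple int),
    (forall i j : 'I_t, tnth a i < tnth b j) /\ weak_determinantal a b F.

End Surfaces.

Inductive listed_quartic_type : seq int -> seq int -> Prop :=
| Len2_1 n of 0 <= n :
    listed_quartic_type [:: 0; 2 + n] [:: 2; 4 + n]
| Len2_2 n of 0 <= n :
    listed_quartic_type [:: 0; 3 + n] [:: 3; 4 + n]
| Len2_3 n of 0 <= n :
    listed_quartic_type [:: 0; 1 + n] [:: 1; 4 + n]
| Len3_1 n of 0 <= n :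
    listed_quartic_type [:: 0; 1; 2 + n] [:: 2; 2; 3 + n]
| Len3_2 n of 0 <= n :
    listed_quartic_type [:: 0; 2 + n; 2 + n] [:: 2; 3 + n; 3 + n]
| Len3_3 n of 0 <= n :
    listed_quartic_type [:: 0; 2 + n; 3 + n] [:: 2; 3 + n; 4 + n]
| Len3_4 m n of 0 <= m & m < n :
    listed_quartic_type [:: 0; 2 + m; 2 + n] [:: 2; 3 + m; 3 + n]
| Len3_5 n of 0 <= n :
    listed_quartic_type [:: 0; 0; 1 + n] [:: 1; 1; 3 + n]
| Len3_6 n of 0 <= n :
    listed_quartic_type [:: 0; 1 + n; 1 + n] [:: 1; 2 + n; 3 + n]
| Len3_7 n of 0 <= n :
    listed_quartic_type [:: 0; 1; 2 + n] [:: 1; 2; 4 + n]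
| Len3_8 m n of 1 <= m & m < n :
    listed_quartic_type [:: 0; m; 1 + n] [:: 1; 1 + m; 3 + n]
| Len3_9 n of 0 <= n :
    listed_quartic_type [:: 0; 0; 2 + n] [:: 1; 2; 3 + n]
| Len3_10 n of 0 <= n :
    listed_quartic_type [:: 0; 1 + n; 2 + n] [:: 1; 3 + n; 3 + n]
| Len3_11 m n of 0 <= m & m <= n :
    listed_quartic_type [:: 0; 1 + m; 3 + n] [:: 1; 3 + m; 4 + n]
| Len4_1 n of 0 <= n :
    listed_quartic_type [:: 0; 0; 0; 1 + n] [:: 1; 1; 1; 2 + n]
| Len4_2 n of 0 <= n :
    listed_quartic_type [:: 0; 1 + n; 1 + n; 1 + n] [:: 1; 2 + n; 2 + n; 2 + n]
| Len4_3 n of 0 <= n :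
    listed_quartic_type [:: 0; 0; 1 + n; 1 + n] [:: 1; 1; 2 + n; 2 + n]
| Len4_4 m n of 0 <= m & m <= n :
    listed_quartic_type [:: 0; 0; 1 + m; 2 + n] [:: 1; 1; 2 + m; 3 + n]
| Len4_5 m n of 0 <= m & m <= n :
    listed_quartic_type [:: 0; 1 + m; 2 + n; 2 + n] [:: 1; 2 + m; 3 + n; 3 + n]
| Len4_6 k m n of 0 <= k & k <= m & m <= n :
    listed_quartic_type [:: 0; 1 + k; 2 + m; 3 + n] [:: 1; 2 + k; 3 + m; 4 + n].

(* Main.v *)
Require Import Defs.
From mathcomp Require Import all_boot all_order all_algebra.
From mathcomp Require Import reals complex mpoly.
From mathcomp Require Import perm zify.

(** Reducibility comes from a gap in the type.  If b_k <= a_{k+1} for some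
    k < t, then, both sequences being sorted, b_j <= a_i whenever j <= k < i,
    so the matrix is block upper triangular and F is the product of the two
    diagonal minors.  Each minor is a form whose degree, a nonempty sum of
    differences b_i - a_i > 0, is positive ([weak_det_gap_reducible]).  Every
    type in the list has such a gap ([listed_quartic_gap]).

    A smooth surface in P^3 is irreducible: if F = G * H, then all the partial
    derivatives of F vanish at a common zero of G and H, and two forms of
    positive degree in at least three variables have a nontrivial common zero
    over a closed field ([forms_common_zero]).  To find one, choose coordinates
    (x, y, z) on a three-dimensional subspace in which both forms have an
    invertible leading coefficient in z.  Their resultant in z is a polynomial
    r(x, y) whose zeros are the points above which the two forms have a common
    root.  At x = y = 0 both forms are multiples of a power of z, so r vanishes
    at the origin.  A plane curve through the origin contains another point
    ([plane_curve_other_zero]), and a common root above it is the desired zero.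

    Hence the type of a smooth weak determinantal quartic has no gap:
    a_{k+1} < b_k for all k.  Since its degree is a sum of t positive integers,
    t <= 4.  For t = 2 the absence of a gap is the determinantal condition
    a_t < b_1.  For t = 4 all the differences b_i - a_i equal 1, so all the a_i
    are equal and again a_t < b_1.  For t = 3, if a_3 >= b_1, then
    a_2 < b_1 <= a_3 < b_2 makes b_2 - a_2 >= 2, so the differences are 1, 2, 1,
    and this forces the type ((0,0,1),(1,2,2)) up to translation. *)

Set Implicit Arguments.
Unset Strict Implicit.
Unset Printing Implicit Defensive.

Import Order.TTheory GRing.Theory Num.Theory.

Local Open Scope ring_scope.

(** * Substitutions into multivariate polynomials *)

Section Substitution.
Variable n : nat.

Lemma mmap_comp (R : nzRingType) (S T : comNzRingType) (f : R -> S)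
    (h : 'I_n -> S) (g : {rmorphism S -> T}) (f' : R -> T) (h' : 'I_n -> T)
    (p : {mpoly R[n]}) :
  (forall c, g (f c) = f' c) -> (forall i, g (h i) = h' i) ->
  g (mmap f h p) = mmap f' h' p.
Proof.
move=> gf gh; rewrite /mmap rmorph_sum; apply: eq_bigr => m _.
rewrite rmorphM gf; congr (_ * _).
rewrite /mmap1 rmorph_prod; apply: eq_bigr => i _.
by rewrite rmorphXn gh.
Qed.

Lemma coefM_top (A : nzRingType) (p q : {poly A}) (d e : nat) :
  (size p <= d.+1)%N -> (size q <= e.+1)%N ->
  (p * q)`_(d + e) = p`_d * q`_e.
Proof.
move=> sp sq; rewrite coefM.
have ltd : (d < (d + e).+1)%N by lia.
rewrite (bigD1 (Ordinal ltd)) //= addKn big1 ?addr0 // => i.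
rewrite -val_eqE /= => ne_id.
have [lt_id|le_di] := ltnP i d.
  rewrite [q`_ _]nth_default ?mulr0 //.
  by apply: leq_trans sq _; lia.
rewrite nth_default ?mul0r //; apply: leq_trans sp _.
by rewrite ltn_neqAle eq_sym ne_id.
Qed.

Variables (R : nzRingType) (A : comNzRingType) (f : {rmorphism R -> A}).
Variables a v : 'I_n -> A.

Let line i : {poly A} := (a i)%:P + v i *: 'X.

(** A product of linear polynomials a + v z has degree at most the number of
    factors, and in that degree its coefficient is the product of the v. *)
Lemma mmap1_line_top (m : 'X_{1..n}) :
  (size (mmap1 line m) <= (mdeg m).+1)%N /\
  (mmap1 line m)`_(mdeg m) = mmap1 v m.
Proof.
have topM (p q : {poly A}) d e c c' :
    (size p <= d.+1)%N /\ p`_d = c -> (size q <= e.+1)%N /\ q`_e = c' ->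
    (size (p * q)%R <= (d + e).+1)%N /\ (p * q)`_(d + e) = c * c'.
  move=> [sp <-] [sq <-]; rewrite coefM_top //; split=> //.
  by apply: leq_trans (size_polyMleq _ _) _; lia.
have topX i k : (size (line i ^+ k) <= k.+1)%N /\ (line i ^+ k)`_k = v i ^+ k.
  elim: k => [|k IHk]; first by rewrite !expr0 size_poly1 coef1.
  rewrite !exprS -[k.+1]add1n; apply: topM => //; split.
    rewrite (leq_trans (size_polyD _ _)) // geq_max.
    rewrite (leq_trans (size_polyC_leq1 _)) //=.
    by rewrite (leq_trans (size_scale_leq _ _)) // size_polyX.
  by rewrite coefD coefC coefZ coefX /= mulr1 add0r.
rewrite /mmap1 mdegE.
elim/big_rec3: _ => [|i c d p _ IH]; first by rewrite size_poly1 coef1.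
exact: topM.
Qed.

(** Restricted to the line a + v z, a form of degree d has degree at most d in z,
    and its coefficient of z^d is its value at v.  So it has degree exactly d, with
    a leading coefficient independent of a, as soon as it does not vanish at v. *)
Lemma mmap_line_top (G : {mpoly R[n]}) (d : nat) : G \is d.-homog ->
  (size (mmap (polyC \o f) line G) <= d.+1)%N /\
  (mmap (polyC \o f) line G)`_d = mmap f v G.
Proof.
move/dhomogP => homG; split.
  rewrite /mmap big_seq; apply: (big_ind (fun p : {poly A} => size p <= d.+1)%N).
  - by rewrite size_poly0.
  - move=> p q sp sq; apply: leq_trans (size_polyD _ _) _.
    by rewrite geq_max sp.
  move=> m /homG <-; rewrite /= mul_polyC.
  by apply: leq_trans (size_scale_leq _ _) _; case: (mmap1_line_top m).
rewrite /mmap coef_sum big_seq [RHS]big_seq; apply: eq_bigr => m /homG <-.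
by rewrite /= coefCM; case: (mmap1_line_top m) => _ ->.
Qed.

End Substitution.

(** * Common zeros of two forms over a closed field *)

Section ClosedField.
Variable K : closedFieldType.

(** A closed field is infinite, so a nonzero polynomial is a nonzero function:
    by induction, view p as a polynomial in its last variable and choose the
    other variables so that its leading coefficient does not vanish. *)
Lemma mpoly_nonroot (n : nat) (p : {mpoly K[n]}) :
  p != 0 -> exists v : 'I_n -> K, p.@[v] != 0.
Proof.
elim: n p => [|n IHn] p nzp.
  exists (fun=> 0); have p_const : p = (p@_(mlead p))%:MP.
    apply/mpolyP => m; rewrite mcoeffC.
    have -> : m = mlead p by apply/mnmP => -[].
    have -> : mlead p = 0%MM by apply/mnmP => -[].
    by rewrite eqxx mulr1.
  by rewrite p_const mevalC mleadc_eq0.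
have nzu : muni p != 0.
  (* Only the leading monomial m0 of p contributes to the coefficient of m0. *)
  pose low (m : 'X_{1..n.+1}) : 'X_{1..n} :=
    [multinom m (widen_ord (leqnSn n) i) | i < n].
  pose m0 := mlead p.
  suff c0 : (muni p)`_(m0 ord_max)@_(low m0) = p@_m0.
    apply: contraNneq nzp => u0; move: c0.
    by rewrite u0 coef0 mcoeff0 => /esym/eqP; rewrite mleadc_eq0.
  rewrite muniE coef_sum raddf_sum (bigD1_seq m0) ?mlead_supp ?msupp_uniq //=.
  rewrite coefZ coefXn eqxx mulr1 mcoeffZ mcoeffX eqxx mulr1 big1 ?addr0 //.
  move=> m ne_m0; rewrite coefZ coefXn.
  have [eq_max|_] := eqVneq; last by rewrite mulr0 mcoeff0.
  rewrite mulr1 mcoeffZ mcoeffX.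
  have [eq_low|_] := eqVneq; last by rewrite mulr0.
  case/eqP: ne_m0; apply/mnmP => i.
  have [lt_in|ge_in] := ltnP i n; last first.
    have -> : i = ord_max by apply/val_inj => /=; have := ltn_ord i; lia.
    by rewrite eq_max.
  move/mnmP/(_ (Ordinal lt_in)): eq_low; rewrite !mnmE.
  by have -> : widen_ord (leqnSn n) (Ordinal lt_in) = i by apply/val_inj.
have [|v nzv] := IHn (lead_coef (muni p)); first by rewrite lead_coef_eq0.
have [|x] := closed_nonrootP (map_poly (meval v) (muni p)) _.
  by rewrite -lead_coef_eq0 lead_coef_map_eq // rmorph0.
rewrite rootE => nzx; 
exists (fun i => match split (cast_ord (esym (addn1 n)) i) with
                 | inl j => v j | inr _ => x end).
apply: contraNneq nzx => p0; rewrite -{}p0; apply/eqP.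
apply: (mmap_comp (g := horner_eval x \o map_poly (meval v))) => [c|i] /=.
  by rewrite map_polyC /horner_eval hornerC /= mevalC.
case: split => [j|_].
  by rewrite map_polyC /horner_eval hornerC /= mevalXU.
by rewrite map_polyX /horner_eval hornerX.
Qed.

Lemma resultant_rootP (p q : {poly K}) : p != 0 ->
  reflect (exists2 z, root p z & root q z) (resultant p q == 0).
Proof.
move=> nzp; rewrite resultant_eq0; apply: (iffP idP) => [gt1|[z pz qz]].
  have /closed_rootP[z] : size (gcdp p q) != 1%N by rewrite gtn_eqF.
  by rewrite root_gcd => /andP[]; exists z.
apply: (@root_size_gt1 _ z); last by rewrite root_gcd pz.
by rewrite gcdp_eq0 negb_and nzp.
Qed.

(** If r(x, y) depends on y, then for some x <> 0 its leading coefficient in y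
    does not vanish at x, and r(x, _) has a root.  Otherwise r vanishes on the
    whole line x = 0. *)
Lemma plane_curve_other_zero (r : {poly {poly K}}) : r.[0].[0] = 0 ->
  exists x y, (x != 0) || (y != 0) /\ r.[y%:P].[x] = 0.
Proof.
move=> r00.
have [/size1_polyC r_const|gt1] := leqP (size r) 1.
  exists 0, 1; rewrite oner_eq0 orbT; split=> //.
  by move: r00; rewrite r_const !hornerC.
have [|x] := closed_nonrootP ('X * lead_coef r) _.
  by rewrite mulf_neq0 ?polyX_eq0 // lead_coef_eq0 -size_poly_gt0 (ltn_trans _ gt1).
rewrite rootM negb_or rootX => /andP[nzx nzl].
have /closed_rootP[y /rootP ry] : size (map_poly (horner_eval x) r) != 1%N.
  by rewrite size_map_poly_id0 // gtn_eqF.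
exists x, y; rewrite nzx; split=> //.
by move: ry; rewrite -{1}(hornerC y x) horner_map.
Qed.

(** The resultant with respect to z reduces this to [plane_curve_other_zero].
    It must commute with the evaluation of x and y: this is why the direction v
    of the third axis is chosen outside the zeros of both forms, so that their
    degrees in z do not drop. *)
Lemma forms_common_zero (n d e : nat) (G H : {mpoly K[n.+3]}) :
  G != 0 -> H != 0 -> (0 < d)%N -> (0 < e)%N ->
  G \is d.-homog -> H \is e.-homog ->
  exists w : 'I_n.+3 -> K,
    [/\ exists i, w i != 0, G.@[w] = 0 & H.@[w] = 0].
Proof.
move=> nzG nzH d_gt0 e_gt0 homG homH.
have [v] := mpoly_nonroot (mulf_neq0 nzG nzH).
rewrite mevalM mulf_eq0 negb_or => /andP[nzGv nzHv].
have eval0 (k : nat) (P : {mpoly K[n.+3]}) (w : 'I_n.+3 -> K) :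
    (0 < k)%N -> P \is k.-homog -> (forall l, w l = 0) -> P.@[w] = 0.
  move=> k_gt0 /dhomogP homP w0; rewrite mevalE big_seq big1 // => m /homP degm.
  have {}degm : (\sum_i m i)%N = k by rewrite -mdegE.
  have [l nzl] : exists l, m l != 0%N.
    apply/existsP; apply: contraTT k_gt0; rewrite negb_exists => /forallP m0.
    by rewrite -degm big1 // => l _; apply/eqP; rewrite -[_ == _]negbK.
  by rewrite (bigD1 l) //= w0 expr0n (negbTE nzl) mul0r mulr0.
have [i nzvi] : exists i, v i != 0.
  apply/existsP; apply: contraNT nzGv; rewrite negb_exists => /forallP v0.
  by apply/eqP/(eval0 d) => // l; apply/eqP; rewrite -[_ == _]negbK.
pose j := lift i ord0; pose k := lift i ord_max.
have ne_ij : i != j by apply: neq_lift.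
have ne_ik : i != k by apply: neq_lift.
have ne_jk : j != k by rewrite (inj_eq lift_inj).
(* pt x y z = x e_j + y e_k + z v, where e_j, e_k and v are independent
   because v has a nonzero coordinate i, different from j and k. *)
pose pt (x y z : K) l := x *+ (l == j) + y *+ (l == k) + v l * z.
pose a l : {poly {poly K}} := 'X%:P *+ (l == j) + 'X *+ (l == k).
(* In {poly {poly {poly K}}} the innermost variable is x, then y, then z. *)
pose cst : {rmorphism K -> {poly {poly K}}} := polyC \o polyC.
pose restr P :=
  mmap (polyC \o cst) (fun l => (a l)%:P + (cst (v l)) *: 'X) P.
pose ev (x y : K) : {rmorphism {poly {poly K}} -> K} :=
  horner_eval x \o horner_eval y%:P.
have evE x y r : ev x y r = r.[y%:P].[x] by [].
have restr_ev P x y z : (map_poly (ev x y) (restr P)).[z] = P.@[pt x y z].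
  apply: (mmap_comp (g := horner_eval z \o map_poly (ev x y))) => [c|l] /=.
    by rewrite map_polyC /= /horner_eval !hornerE.
  rewrite rmorphD /= map_polyC map_polyZ map_polyX /= /horner_eval.
  by rewrite /a /pt !hornerE !hornerMn !hornerE.
have restr_top P c : P \is c.-homog -> P.@[v] != 0 ->
    size (restr P) = c.+1 /\ lead_coef (restr P) = cst P.@[v].
  move=> homP nzPv.
  have [sP cP] := mmap_line_top cst a (cst \o v) homP.
  have {}cP : (restr P)`_c = cst P.@[v].
    by rewrite cP; symmetry; apply: mmap_comp.
  have sz : size (restr P) = c.+1.
    apply/eqP; rewrite eqn_leq sP ltnNge; apply: contraNN nzPv => le_sc.
    by have := cP; rewrite nth_default // => /esym/eqP; rewrite !polyC_eq0.
  by rewrite lead_coefE sz.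
have [sG lG] := restr_top _ _ homG nzGv.
have [sH lH] := restr_top _ _ homH nzHv.
have ev_lead x y P : ev x y (cst P) = P by rewrite evE !hornerC.
have ev_res x y : ev x y (resultant (restr G) (restr H)) =
    resultant (map_poly (ev x y) (restr G)) (map_poly (ev x y) (restr H)).
  by apply: map_resultant; rewrite ?lG ?lH ev_lead.
have nzGxy x y : map_poly (ev x y) (restr G) != 0.
  by rewrite -size_poly_eq0 size_map_poly_id0 ?sG // lG ev_lead.
have [|x [y [nzxy res0]]] :=
    @plane_curve_other_zero (resultant (restr G) (restr H)).
  have := evE 0 0 (resultant (restr G) (restr H)); rewrite polyC0 => <-.
  rewrite ev_res; apply/eqP/resultant_rootP => //.
  have pt0 l : pt 0 0 0 l = 0 by rewrite /pt !mul0rn mulr0 !addr0.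
  by exists 0; apply/rootP; rewrite restr_ev;
    [apply: (eval0 d) | apply: (eval0 e)].
move: res0; rewrite -evE ev_res => /eqP/(resultant_rootP _ (nzGxy x y))[z].
rewrite !rootE !restr_ev => /eqP Gz /eqP Hz.
exists (pt x y z); split=> //.
have [z0|nzz] := eqVneq z 0; last first.
  exists i; rewrite /pt (negbTE ne_ij) (negbTE ne_ik) !add0r.
  exact: mulf_neq0.
case/orP: nzxy => [nzx|nzy].
  by exists j; rewrite /pt z0 eqxx (negbTE ne_jk) mulr0 !addr0.
by exists k; rewrite /pt z0 eqxx (eq_sym k) (negbTE ne_jk) mulr0 add0r addr0.
Qed.

End ClosedField.

(** * Determinants of graded matrices *)

(** In the Leibniz expansion, the term of a permutation s either contains a
    zero entry or has degree \sum_i (beta (s i) - alpha i), and this sum does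
    not depend on s. *)
Lemma dhomog_det (A : comNzRingType) (n t d : nat) (alpha beta : 'I_t -> int)
    (S : 'M[{mpoly A[n]}]_t) :
  (forall i j, alpha i < beta j -> S i j \is `|beta j - alpha i|%N.-homog) ->
  (forall i j, beta j <= alpha i -> S i j = 0) ->
  \sum_i (beta i - alpha i) = d%:Z -> \det S \is d.-homog.
Proof.
move=> homS S0 sum_d; apply: rpred_sum => s _; rewrite rpredMsign.
have [/forallP lt_s|] := boolP [forall i, alpha i < beta (s i)]; last first.
  rewrite negb_forall => /existsP[l]; rewrite -leNgt => /S0 Sl0.
  by rewrite (bigD1 l) //= Sl0 mul0r rpred0.
have -> : d = (\sum_i `|beta (s i) - alpha i|)%N.
  apply/eqP; rewrite -eqz_nat -sum_d sumrB (reindex_perm s) /= -sumrB.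
  rewrite (big_morph Posz PoszD (erefl 0%:Z)); apply/eqP/eq_bigr => i _.
  by have := lt_s i; lia.
elim/big_rec2: _ => [|i p c _ IH]; first exact: dhomog1.
by apply: dhomogM => //; apply: homS.
Qed.

(** * Weak determinantal surfaces *)

Section Quartics.
Variable R : realType.
Implicit Types F : {mpoly R[i][4]}.

(** By the Leibniz rule a product is singular where both its factors vanish. *)
Lemma reducible_not_smooth F : reducible F -> ~ smooth F.
Proof.
move=> [G [H [[nzG [d d_gt0 homG]] [nzH [e e_gt0 homH]] ->]]] smF.
have [w [nzw Gw Hw]] := forms_common_zero nzG nzH d_gt0 e_gt0 homG homH.
have [|i] := smF w nzw; first by rewrite mevalM Gw mul0r.
by rewrite mderivM mevalD !mevalM Gw Hw mulr0 mul0r addr0 eqxx.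
Qed.

(** The gap makes the lower left block, rows i > k and columns j <= k in the
    numbering from 0, vanish. *)
Lemma weak_det_gap_reducible (t : nat) (a b : t.-tuple int) F (k : nat) :
  F != 0 -> weak_determinantal a b F -> (k.+1 < t)%N ->
  b`_k <= a`_k.+1 -> reducible F.
Proof.
move=> nzF [[_ sa sb lt_ab] [S [homS S0 FS]]] lt_kt gap.
have [l def_t] : exists l, t = (k.+1 + l.+1)%N by exists (t - k.+2)%N; lia.
subst t.
have SE : S = block_mx (ulsubmx S) (ursubmx S) 0 (drsubmx S).
  rewrite -[LHS]submxK; congr block_mx; apply/matrixP => i j.
  rewrite !mxE; apply: S0; rewrite !(tnth_nth 0) /=.
  apply: (le_trans (y := b`_k)).
    apply: (sorted_leq_nth le_trans le_refl _ sb); rewrite ?inE ?size_tuple;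
    by have := ltn_ord j; lia.
  apply: (le_trans gap); apply: (sorted_leq_nth le_trans le_refl _ sa);
  by rewrite ?inE ?size_tuple; have := ltn_ord i; lia.
(* Both diagonal blocks are graded by the corresponding entries of a and b. *)
have blockP (u : nat) (e : 'I_u.+1 -> 'I_(k.+1 + l.+1))
    (T : 'M[{mpoly R[i][4]}]_u.+1) :
    (forall i j, T i j = S (e i) (e j)) -> \det T != 0 -> surface (\det T).
  move=> TE nzT; split=> //.
  pose deg : int := \sum_i (tnth b (e i) - tnth a (e i)).
  exists `|deg|%N.
    rewrite absz_gt0 /deg; apply: lt0r_neq0; rewrite big_ord_recl.
    apply: ltr_pwDl; first by rewrite subr_gt0.
    by apply: sumr_ge0 => i _; rewrite subr_ge0 ltW.
  apply: (dhomog_det (alpha := fun i => tnth a (e i))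
                     (beta := fun i => tnth b (e i))).
  - by move=> i j lt_ij; rewrite TE homS.
  - by move=> i j le_ij; rewrite TE S0.
  rewrite gez0_abs //.
  by apply: sumr_ge0 => i _; rewrite subr_ge0 ltW.
have FE : F = \det (ulsubmx S) * \det (drsubmx S).
  by rewrite FS {1}SE det_ublock.
move: (nzF); rewrite FE mulf_eq0 negb_or => /andP[nzU nzD].
exists (\det (ulsubmx S)), (\det (drsubmx S)); split=> //.
  by apply: (blockP _ (lshift l.+1)) => // i j; rewrite !mxE.
by apply: (blockP _ (@rshift k.+1 l.+1)) => // i j; rewrite !mxE.
Qed.

Lemma listed_quartic_gap (sa sb : seq int) : listed_quartic_type sa sb ->
  exists2 k, (k.+1 < size sa)%N & sb`_k <= sa`_k.+1.
Proof.
case=> *;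
  solve [ exists 0%N => [//|] /=; lia
        | exists 1%N => [//|] /=; lia
        | exists 2%N => [//|] /=; lia ].
Qed.

Lemma weak_det_shift (t : nat) (a b a' b' : t.-tuple int) (c : int) F :
  (forall i, tnth a i = tnth a' i + c) ->
  (forall i, tnth b i = tnth b' i + c) ->
  weak_admissible a' b' -> weak_determinantal a b F ->
  weak_determinantal a' b' F.
Proof.
move=> aE bE adm [_ [S [homS S0 FS]]]; split=> //; exists S; split=> // i j.
  move=> lt_ab; have := homS i j; rewrite aE bE ltrD2r opprD addrACA subrr addr0.
  exact.
by move=> le_ba; apply: S0; rewrite aE bE lerD2r.
Qed.

(** Without gaps and in degree 4 only finitely many types remain, up to
    translation, and they are found by linear arithmetic. *)
Lemma smooth_quartic_type F : F != 0 -> smooth F ->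
  weak_determinantal_of_degree 4 F ->
  determinantal F \/ weak_determinantal [tuple 0; 0; 1] [tuple 1; 2; 2] F.
Proof.
move=> nzF smF [t [a [b [deg4 wdF]]]].
pose A k : int := a`_k; pose B k : int := b`_k.
have aE i : tnth a i = A i by rewrite (tnth_nth 0).
have bE i : tnth b i = B i by rewrite (tnth_nth 0).
have nogap k : (k.+1 < t)%N -> A k.+1 < B k.
  move=> lt_kt; rewrite ltNge; apply/negP => gap.
  exact: (reducible_not_smooth (weak_det_gap_reducible nzF wdF lt_kt gap) smF).
have [[t_ge2 sa sb lt_ab] _] := wdF.
have A_mono i j : (i <= j < t)%N -> A i <= A j.
  move=> /andP[le_ij lt_jt]; apply: (sorted_leq_nth le_trans le_refl _ sa) => //;
  by rewrite inE size_tuple // (leq_ltn_trans le_ij).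
have B_mono i j : (i <= j < t)%N -> B i <= B j.
  move=> /andP[le_ij lt_jt]; apply: (sorted_leq_nth le_trans le_refl _ sb) => //;
  by rewrite inE size_tuple // (leq_ltn_trans le_ij).
have ltAB i : (i < t)%N -> A i < B i.
  by move=> lt_it; have := lt_ab (Ordinal lt_it); rewrite aE bE.
have {}deg4 : \sum_(0 <= i < t) (B i - A i) = 4.
  by rewrite big_mkord -[RHS]deg4; apply: eq_bigr => i _; rewrite aE bE.
have det_of_lt : A t.-1 < B 0%N -> determinantal F.
  move=> lt_last; exists t, a, b; split=> // i j; rewrite aE bE.
  apply: le_lt_trans (lt_le_trans lt_last (B_mono 0%N j _)); last first.
    by rewrite leq0n ltn_ord.
  by apply: A_mono; have := ltn_ord i; lia.
(* The degree is a sum of t positive integers. *)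
have t_le4 : (t <= 4)%N.
  have : \sum_(i < t) 1 <= \sum_(i < t) (B i - A i).
    by apply: ler_sum => i _; have := ltAB i (ltn_ord i); lia.
  by rewrite -(big_mkord xpredT (fun i => B i - A i)) deg4 sumr_const card_ord; lia.
move: A B aE bE nogap A_mono B_mono ltAB deg4 det_of_lt => A B.
case: t a b t_ge2 t_le4 wdF {sa sb lt_ab} => [|[|[|[|[|t]]]]] // a b _ _ wdF aE bE;
  rewrite unlock /= => nogap A_mono B_mono ltAB deg4 det_of_lt.
- by left; apply/det_of_lt/nogap.
- (* The only type with a_3 >= b_1 is (c,c,c+1), (c+1,c+2,c+2), where c = a_1. *)
  have [/det_of_lt|ge_last] := ltP (A 2%N) (B 0%N); first by left.
  right.
  have A01 := A_mono 0%N 1%N isT; have B12 := B_mono 1%N 2%N isT.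
  have gap0 := nogap 0%N isT; have gap1 := nogap 1%N isT.
  have lt0 := ltAB 0%N isT; have lt2 := ltAB 2%N isT.
  apply: (weak_det_shift (c := A 0%N) _ _ _ wdF).
  + by case=> [[|[|[|]]] //= lti]; rewrite aE (tnth_nth 0) /=; lia.
  + by case=> [[|[|[|]]] //= lti]; rewrite bE (tnth_nth 0) /=; lia.
  by split=> //; case=> [[|[|[|]]] //= lti]; rewrite !(tnth_nth 0).
left; apply: det_of_lt => /=.
have gap0 := nogap 0%N isT; have gap1 := nogap 1%N isT.
have gap2 := nogap 2%N isT.
have := ltAB 0%N isT; have := ltAB 1%N isT; have := ltAB 2%N isT.
have := ltAB 3%N isT; lia.
Qed.

End Quartics.

Theorem corollary4p2 (R : realType) :
  (forall (t : nat) (a b : t.-tuple int) (F : {mpoly R[i][4]}),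
     listed_quartic_type a b -> surface F -> weak_determinantal a b F ->
     reducible F)
  /\
  (forall F : {mpoly R[i][4]},
     surface F -> smooth F -> weak_determinantal_of_degree 4 F ->
     determinantal F \/
     weak_determinantal [tuple 0; 0; 1] [tuple 1; 2; 2] F).
Proof.
split=> [t a b F /listed_quartic_gap[k] + le_ba [nzF _] wdF | F [nzF _]].
  by rewrite size_tuple => lt_kt; apply: weak_det_gap_reducible wdF lt_kt le_ba.
exact: smooth_quartic_type.
Qed.
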